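(* Let $a,b$ be nonzero real numbers, let $\mathcal{F}_n(a,b,x)$ be the bi-periodic Fibonacci matrix polynomials, let $\mathcal{A}_{n}(a,b,x)=\sqrt{x}\,a^{\varepsilon(n)/2}b^{(1-\varepsilon(n))/2}\mathcal{F}_{n}(a,b,x)$, let $k=x\sqrt{ab}$, and let $r_n(a,b,x)=\sum_{i=0}^{n}\binom{n}{i}k^{i}\mathcal{A}_i(a,b,x)$ be the rising $k$-binomial transform. Then for every integer $n\ge 0$, $$r_{n}(a,b,x)=\mathcal{A}_{2n}(a,b,x).$$
   Context: Here $\varepsilon(n)=n-2\lfloor n/2\rfloor$ and $x$ is an indeterminate over $\mathbb{R}$; everything takes place in an algebraic closure of $\mathbb{R}(x)$, in which square roots $\sqrt a,\sqrt b,\sqrt x$ are fixed once and for all, with $\sqrt{ab}=\sqrt a\sqrt b$, and half-integer powers of $a$ and $b$ are taken with respect to $\sqrt a,\sqrt b$. The bi-periodic Fibonacci matrix polynomials are the $2\times 2$ matrices defined by $\mathcal{F}_0(a,b,x)=\begin{pmatrix}1&0\\0&1\end{pmatrix}$, $\mathcal{F}_1(a,b,x)=\begin{pmatrix}bx&\frac{b}{a}\\1&0\end{pmatrix}$ and, for $n\ge 2$, $\mathcal{F}_n=ax\,\mathcal{F}_{n-1}+\mathcal{F}_{n-2}$ if $n$ is even, $\mathcal{F}_n=bx\,\mathcal{F}_{n-1}+\mathcal{F}_{n-2}$ if $n$ is odd. *)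

(* Defs.v *)
From HB Require Import structures.
From mathcomp Require Import all_boot all_order all_algebra.
From mathcomp Require Import reals.

Set Implicit Arguments.
Unset Strict Implicit.
Unset Printing Implicit Defensive.

Import GRing.Theory.
Local Open Scope ring_scope.

Definition epsilon (n : nat) : nat := (n - 2 * (n %/ 2))%N.

Definition mx2 (T : Type) (p q r s : T) : 'M[T]_2 :=
  \matrix_(i < 2, j < 2)
    if i == 0 then (if j == 0 then p else q) else (if j == 0 then r else s).

Fixpoint biperiodic_fib_mx (R : realType) (a b : R) (n : nat) :
    'M[{poly R}]_2 :=
  match n with
  | 0 => 1%:M
  | 1 => mx2 (b *: 'X) (b / a)%:P 1 0
  | (m.+1 as n1).+1 =>
      (if odd n then b *: 'X else a *: 'X) *: biperiodic_fib_mx a b n1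
      + biperiodic_fib_mx a b m
  end.

Definition algebraic_closure (F : fieldType) (K : closedFieldType)
    (iota : {rmorphism F -> K}) : Prop :=
  forall z : K, algebraicOver iota z.

Section ScaledSequence.

Variables (R : realType) (K : closedFieldType).
Variable iota : {rmorphism {fraction {poly R}} -> K}.

Definition embed (p : {poly R}) : K := iota (tofrac p).

(* [sa], [sb], [sx], [sab] stand for the chosen square roots of a, b, x and ab,
   so that a^(m/2) is [sa ^+ m] and b^(m/2) is [sb ^+ m]. *)
Variables (a b : R) (sa sb sx sab : K).

Definition scaled_fib_mx (n : nat) : 'M[K]_2 :=
  (sx * sa ^+ epsilon n * sb ^+ (1 - epsilon n)) *:
    map_mx embed (biperiodic_fib_mx a b n).

Definition rising_ratio : K := embed 'X * sab.

Definition rising_binomial_transform (k : K) (A : nat -> 'M[K]_2) (n : nat) :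
    'M[K]_2 :=
  \sum_(0 <= i < n.+1) ('C(n, i)%:R * k ^+ i) *: A i.

End ScaledSequence.

(* Main.v *)
Require Import Defs.
From HB Require Import structures.
From mathcomp Require Import all_boot all_order all_algebra.
From mathcomp Require Import reals ring zify.

Set Implicit Arguments.
Unset Strict Implicit.
Unset Printing Implicit Defensive.

Import GRing.Theory.
Local Open Scope ring_scope.

(** The weight a^(epsilon(n)/2) b^((1-epsilon(n))/2) removes the parity from the
    recurrence.  For even n, multiplying F_(n+2) = a x F_(n+1) + F_n by the
    weight sqrt b of n and n + 2 gives the coefficient
    sqrt b * a x = (x sqrt a sqrt b) * sqrt a, and the remaining sqrt a is the
    weight of n + 1; for odd n the roles of a and b are exchanged.  In both
    cases A_(n+2) = k A_(n+1) + A_n with the same k = x sqrt(ab)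
    ([scaled_fib_mx_rec]).

    With E the shift on sequences this says E^2 = 1 + k E, hence
    (1 + k E)^n = E^(2n); expanding the left side by the binomial theorem and
    evaluating at index 0 gives the identity
    ([rising_binomial_transform_shift]). *)

(** This is (1 + k E)^n = E^(2n) read at an arbitrary index [m]: the induction
    (1 + k E)^(n+1) = (1 + k E)^n + k (1 + k E)^n E, which is Pascal's rule,
    uses the induction hypothesis both at [m] and at [m.+1]. *)
Lemma rising_binomial_transform_shift (K : closedFieldType) (k : K)
    (A : nat -> 'M[K]_2) :
    (forall m, A m.+2 = k *: A m.+1 + A m) ->
  forall n m,
    rising_binomial_transform k (fun i => A (m + i)%N) n = A (m + 2 * n)%N.
Proof.
move=> recA; elim=> [|n IHn] m.
  by rewrite /rising_binomial_transform big_nat1 bin0 mulr1 scale1r.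
have -> : (m + 2 * n.+1 = (m + 2 * n).+2)%N by lia.
rewrite recA addrC -addSn -!IHn /rising_binomial_transform scaler_sumr.
rewrite big_nat_recl // [in RHS]big_nat_recl // -addrA !bin0; congr (_ + _).
(* Extending the first sum to i = n is harmless because 'C(n, n.+1) = 0. *)
have -> : \sum_(0 <= i < n) ('C(n, i.+1)%:R * k ^+ i.+1) *: A (m + i.+1)%N
        = \sum_(0 <= i < n.+1) ('C(n, i.+1)%:R * k ^+ i.+1) *: A (m + i.+1)%N.
  by rewrite [RHS]big_nat_recr //= bin_small // mul0r scale0r addr0.
rewrite -big_split; apply: eq_bigr => i _ /=.
rewrite binS natrD mulrDl scalerDl scalerA addnS addSn; congr (_ + _ *: _).
by rewrite exprS mulrCA.
Qed.

Lemma epsilonE n : epsilon n = odd n.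
Proof. by rewrite /epsilon; lia. Qed.

Lemma biperiodic_fib_mxSS (R : realType) (a b : R) n :
  biperiodic_fib_mx a b n.+2 =
    ((if odd n then b else a) *: 'X) *: biperiodic_fib_mx a b n.+1
    + biperiodic_fib_mx a b n.
Proof. by rewrite /= negbK; case: (odd n). Qed.

Lemma scaled_fib_mx_rec (R : realType) (K : closedFieldType)
    (iota : {rmorphism {fraction {poly R}} -> K}) (a b : R) (sa sb sx : K) :
    sa ^+ 2 = embed iota a%:P -> sb ^+ 2 = embed iota b%:P ->
  forall n, scaled_fib_mx iota a b sa sb sx n.+2 =
    rising_ratio iota (sa * sb) *: scaled_fib_mx iota a b sa sb sx n.+1
    + scaled_fib_mx iota a b sa sb sx n.
Proof.
move=> hsa hsb n; apply/matrixP => i j.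
rewrite /scaled_fib_mx /rising_ratio biperiodic_fib_mxSS !epsilonE !mxE.
rewrite -mul_polyC /= negbK /embed !(rmorphD, rmorphM) /= -!/(embed iota _).
by case: (odd n); rewrite -?hsa -?hsb /=; ring.
Qed.

Theorem theorem3p5 (R : realType) (a b : R) (ha : a != 0) (hb : b != 0)
    (K : closedFieldType) (iota : {rmorphism {fraction {poly R}} -> K})
    (hK : algebraic_closure iota)
    (sa sb sx sab : K)
    (hsa : sa ^+ 2 = embed iota a%:P)
    (hsb : sb ^+ 2 = embed iota b%:P)
    (hsx : sx ^+ 2 = embed iota 'X)
    (hsab : sab = sa * sb)
    (n : nat) :
  rising_binomial_transform (rising_ratio iota sab)
    (scaled_fib_mx iota a b sa sb sx) n
  = scaled_fib_mx iota a b sa sb sx (2 * n)%N.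
Proof.
rewrite hsab.
exact: (rising_binomial_transform_shift (scaled_fib_mx_rec sx hsa hsb) n 0).
Qed.
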